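(* Fix an integer $k\ge2$ and a constant $C>0$. For every $\epsilon>0$ the system $$\begin{cases}|n_1^k+n_2^k+n_3^k-n_4^k-n_5^k-n_6^k|\le CN^{k-2}\\ n_1+n_2+n_3=n_4+n_5+n_6\end{cases}$$ has $O(N^{3+\epsilon})$ solutions in integers $n_1,\dots,n_6$ with $n_i\sim N$.
   Context: $n_i\sim N$ means $c_1N\le n_i\le c_2N$ for fixed constants $0<c_1<c_2$. The implicit constant in $O(N^{3+\epsilon})$ may depend on $k,C,\epsilon,c_1,c_2$ but not on $N\ge1$. *)

(* Defs.v *)
From HB Require Import structures.
From mathcomp Require Import all_boot all_order all_algebra.
From mathcomp Require Import all_classical all_reals all_analysis.

Set Implicit Arguments.
Unset Strict Implicit.
Unset Printing Implicit Defensive.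

Import Order.TTheory GRing.Theory Num.Theory.
Local Open Scope classical_set_scope.
Local Open Scope ring_scope.

(* $m \sim N$ with constants $c_1, c_2$; not a bound on |m|: such m is positive
   as soon as c1 and N are. *)
Definition sim_to (R : realType) (c1 c2 N : R) (m : int) : Prop :=
  c1 * N <= m%:~R <= c2 * N.

(* The unknowns $n_1, \dots, n_6$ are n 0, ..., n 5, the numerals being elements
   of 'I_6. *)
Definition solutions (R : realType) (k : nat) (C c1 c2 N : R) :
    set {ffun 'I_6 -> int} :=
  [set n : {ffun 'I_6 -> int} | [/\ forall i : 'I_6, sim_to c1 c2 N (n i),
      `|(n 0 ^+ k + n 1 ^+ k + n 2 ^+ k
         - n 3 ^+ k - n 4 ^+ k - n 5 ^+ k)%:~R| <= C * N ^+ (k - 2)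
    & n 0 + n 1 + n 2 = n 3 + n 4 + n 5]].

(* Main.v *)
Require Import Defs.
From HB Require Import structures.
From mathcomp Require Import all_boot all_order all_algebra.
From mathcomp Require Import finmap zify ring lra.
From mathcomp Require Import all_classical all_reals all_analysis.

(** The solutions are the coincidences, up to a tolerance, among sums of three
    points of the plane curve (x, f x) with f x = x^k / (c1 N)^(k-2): dividing
    the inequality by (c1 N)^(k-2) makes the tolerance a constant T, and makes
    f'' of size 1 on [c1 N, c2 N].  The only arithmetic input is that the
    abscissae are 1-separated; the rest is a bound for curves with f'' of size 1,
    and this class is stable under restriction to subintervals, so that no
    rescaling is ever needed.

    Let E(A, B, C) count the near solutions of
    (a - a') + (b - b') + (c - c') = 0 with a, a' in A, b, b' in B and c, c' in C
    (the combinatorial form of the integral of |F_A|^2 |F_B|^2 |F_C|^2 for the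
    exponential sums F of the three sets), and let J(L) be the largest E(A, A, A)
    for A in an interval of length L.  The claim is J(L) << L^(3 + eta), proved
    by induction on scales with the method of efficient congruencing, where
    residue classes are replaced by intervals.

    - Cauchy-Schwarz (energy_CauchySchwarz): E(A,B,C)^2 <= 9 E(A,B,B) E(A,C,C),
      with the same tolerance on both sides.
    - Transversality (transversal_close, transversal_refine): if A and B lie at
      distance D >> L and B has length q, subtracting the tangent to the curve at
      a point of B shows that the two points of A in a solution counted by
      E(A, B, B) satisfy |a - a'| << (q^2 + T) / D.  So A may be cut into
      intervals of length about q^2 / L, at the cost only of their number.
    - Iteration (bilinear_iteration): Cauchy-Schwarz turns E(A, B, B) into the
      geometric mean of E(B, A, A) and E(B, B, B).  Now A is the short set and
      plays the role of B in the next refinement, while J is bounded at the scale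
      of B by induction.  For lengths L t and L t^2, each round replaces t by
      t^2 and gains the same factor t^eta, the excess of the exponent 3 + eta
      over the critical exponent 3.
    - Broad and narrow triples (broad_narrow_energy): triples within L/K of each
      other contribute O(K^2) J(3 L/K) << K^-1 L^(3 + eta), negligible for K
      large.  Every other triple has one point far from the two others, and
      Cauchy-Schwarz reduces it to bilinear quantities at scale L t^2, with a
      loss t^-12 that about 13 / eta rounds of the iteration compensate.

    Since eta is fixed, K, t and the number of rounds are constants, and the
    induction closes for every L beyond a constant (energy_descent,
    energy_bound). *)

Set Implicit Arguments.
Unset Strict Implicit.
Unset Printing Implicit Defensive.

Import Order.TTheory GRing.Theory Num.Theory.
Local Open Scope ring_scope.

(** * Counting near coincidences *)

Lemma sum_CauchySchwarz (I : Type) (s : seq I) (a b : I -> nat) :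
  ((\sum_(i <- s) a i * b i) ^ 2
     <= (\sum_(i <- s) a i ^ 2) * (\sum_(i <- s) b i ^ 2))%N.
Proof.
elim: s => [|i s IHs]; first by rewrite !big_nil.
rewrite !big_cons; move: IHs.
set S := (\sum_(j <- s) a j * b j)%N; set P := (\sum_(j <- s) a j ^ 2)%N.
set Q := (\sum_(j <- s) b j ^ 2)%N; move: (a i) (b i) => x y IH.
have cross : (2 * (x * y * S) <= x ^ 2 * Q + y ^ 2 * P)%N.
  rewrite -leq_sqr; have := nat_AGM2 (x ^ 2 * Q) (y ^ 2 * P).
  apply: leq_trans.
  have -> : ((2 * (x * y * S)) ^ 2 = 4 * (x ^ 2 * y ^ 2 * S ^ 2))%N by ring.
  have -> : (4 * (x ^ 2 * Q * (y ^ 2 * P)) = 4 * (x ^ 2 * y ^ 2 * (P * Q)))%N.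
    by ring.
  by rewrite !leq_mul2l IH !orbT.
by lia.
Qed.

Lemma card_le_inj (X Y : finType) (h : X -> Y) (A : {pred X}) (B : {pred Y}) :
  {in A &, injective h} -> {in A, forall x, h x \in B} -> (#|A| <= #|B|)%N.
Proof.
move=> injh AB; rewrite -(card_in_image injh); apply: subset_leq_card.
by apply/fintype.subsetP => _ /fintype.imageP[x xA ->]; apply: AB.
Qed.

Lemma card_le_sum (I Y : finType) (A : {set Y}) (B : I -> {set Y}) :
  (forall y, y \in A -> exists i, y \in B i) -> (#|A| <= \sum_i #|B i|)%N.
Proof.
move=> AB; under eq_bigr do rewrite -sum1_card big_mkcond /=.
rewrite exchange_big -sum1_card big_mkcond; apply: leq_sum => y _.
by case: ifP => // /AB[i yi]; rewrite (bigD1 i) //= yi.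
Qed.

Section Coincidences.
Variables (X : finType) (K : eqType).
Implicit Types (W : {set X}) (g h : X -> K).

Definition coincidences W W' g h : nat :=
  \sum_(x in W) \sum_(y in W') (g x == h y).

Lemma sum_eq_both (s : seq K) (u v : K) : uniq s ->
  (\sum_(k <- s) (u == k) * (v == k) = (u == v) && (u \in s))%N.
Proof.
elim: s => [|k s IHs]; first by rewrite big_nil andbF.
rewrite big_cons /= in_cons => /andP[ks /IHs ->].
have [->|] /= := eqVneq u k; last by [].
by rewrite (negbTE ks) andbF addn0 mul1n andbT eq_sym.
Qed.

(** Over the values v of g and h, the left-hand count is the sum of the
    products of the numbers of solutions of g x = v and of h y = v. *)
Lemma coincidences_CauchySchwarz W W' g h :
  (coincidences W W' g h ^ 2
     <= coincidences W W g g * coincidences W' W' h h)%N.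
Proof.
pose s := undup [seq g x | x <- enum W].
have us : uniq s by apply: undup_uniq.
have sum_keys V V' (g1 g2 : X -> K) :
    (\sum_(k <- s) (\sum_(x in V) (g1 x == k)) * (\sum_(y in V') (g2 y == k))
     = \sum_(x in V) \sum_(y in V') ((g1 x == g2 y) && (g1 x \in s)))%N.
  under eq_bigr => k _ do rewrite big_distrlr /=.
  rewrite exchange_big /=; apply: eq_bigr => x _.
  rewrite exchange_big /=; apply: eq_bigr => y _.
  exact: sum_eq_both.
have gs x : x \in W -> g x \in s.
  by move=> xW; rewrite mem_undup map_f ?mem_enum.
have -> : coincidences W W' g h =
    (\sum_(k <- s) (\sum_(x in W) (g x == k)) * (\sum_(y in W') (h y == k)))%N.
  rewrite sum_keys; apply: eq_bigr => x xW; apply: eq_bigr => y _.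
  by rewrite gs // andbT.
apply: leq_trans (sum_CauchySchwarz _ _ _) _.
under eq_bigr do rewrite -mulnn.
under [X in (_ * X)%N]eq_bigr do rewrite -mulnn.
rewrite !sum_keys.
by apply: leq_mul; apply: leq_sum => x _; apply: leq_sum => y _;
  case: (_ == _); case: (_ \in _).
Qed.

End Coincidences.

Section NearPairs.
Variable R : realType.

(** The linear equation is exact, the other one holds up to T. *)
Definition near_zero (T : R) (u : R * R) : bool := (u.1 == 0) && (`|u.2| <= T).

Variables (X : finType) (P : X -> R * R) (T : R).
Hypothesis T0 : 0 < T.
Implicit Types (W : {set X}).

Definition near_pairs W W' : nat :=
  #|[set t : X * X | [&& t.1 \in W, t.2 \in W' & near_zero T (P t.1 - P t.2)]]|.

Lemma near_pairsE W W' : near_pairs W W' =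
  (\sum_(x in W) \sum_(y in W') near_zero T (P x - P y)%R)%N.
Proof.
rewrite /near_pairs -sum1_card pair_big /= big_mkcond [RHS]big_mkcond /=.
apply: eq_bigr => -[x y] _; rewrite inE /=.
by case: (_ \in _); case: (_ \in _); case: near_zero.
Qed.

Lemma near_pairs_sub W1 W2 W1' W2' : W1 \subset W2 -> W1' \subset W2' ->
  (near_pairs W1 W1' <= near_pairs W2 W2')%N.
Proof.
move=> s1 s2; apply: subset_leq_card; apply/fintype.subsetP => -[x y].
by rewrite !inE /= => /and3P[/(fintype.subsetP s1)-> /(fintype.subsetP s2)-> ->].
Qed.

(** A near pair falls in the same bucket or in two consecutive ones; the shift
    j makes the latter equality as well. *)
Let bucket (j : int) (x : X) : R * int := ((P x).1, Num.floor ((P x).2 / T) + j).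

Lemma same_bucket_near x y j : bucket j x = bucket j y ->
  near_zero T (P x - P y).
Proof.
move=> [e1 /addIr e2]; rewrite /near_zero /= e1 subrr eqxx /=.
have := floor_itv ((P x).2 / T); have := floor_itv ((P y).2 / T).
rewrite e2 !ler_pdivlMr // !ltr_pdivrMr // intrD => /andP[a b] /andP[c d].
by rewrite ler_norml; apply/andP; split; nra.
Qed.

Lemma near_bucket x y : near_zero T (P x - P y) ->
  [|| bucket 0 x == bucket (-1) y, bucket 0 x == bucket 0 y
    | bucket 0 x == bucket 1 y].
Proof.
move=> /andP[/=]; rewrite subr_eq0 => /eqP e1 e2.
rewrite /bucket !xpair_eqE e1 eqxx /= !addr0.
set u := Num.floor _; set v := Num.floor _.
have := floor_itv ((P x).2 / T); have := floor_itv ((P y).2 / T).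
rewrite -/u -/v !ler_pdivlMr // !ltr_pdivrMr // !intrD => /andP[a b] /andP[c d].
move: e2; rewrite ler_norml => /andP[e f].
have vu : (u < v + 2)%R.
  by rewrite -(ltr_int R) intrD -(ltr_pM2r T0); nra.
have uv : (v < u + 2)%R.
  by rewrite -(ltr_int R) intrD -(ltr_pM2r T0); nra.
by lia.
Qed.

(** Sorting by bucket loses a factor 3 for the three possible shifts.
    Conversely two elements in one bucket are near with the same T, so no
    tolerance is lost and the inequality can be used any number of times. *)
Lemma near_pairs_CauchySchwarz W W' :
  (near_pairs W W' ^ 2 <= 9 * near_pairs W W * near_pairs W' W')%N.
Proof.
pose c j := coincidences W W' (bucket 0) (bucket j).
have le3 : (near_pairs W W' <= c (-1)%R + c 0%R + c 1%R)%N.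
  rewrite near_pairsE /c /coincidences -!big_split /=.
  apply: leq_sum => x _; rewrite -!big_split /=; apply: leq_sum => y _.
  case n: near_zero => //; have := near_bucket n.
  by case: (_ == _); case: (_ == _); case: (_ == _).
have self V j : (coincidences V V (bucket j) (bucket j) <= near_pairs V V)%N.
  rewrite near_pairsE; apply: leq_sum => x _; apply: leq_sum => y _.
  by case: eqP => // /same_bucket_near ->.
have cj j : (c j ^ 2 <= near_pairs W W * near_pairs W' W')%N.
  apply: leq_trans (coincidences_CauchySchwarz _ _ _ _) _.
  by rewrite leq_mul ?self.
move: (cj (-1)) (cj 0) (cj 1) le3; move: (c (-1)) (c 0) (c 1) (near_pairs W W').
move=> u v w z; set M := (_ * _)%N => hu hv hw hz.
have : (z ^ 2 <= (u + v + w) ^ 2)%N by rewrite leq_sqr.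
by rewrite -mulnA -/M => /leq_trans; apply; nia.
Qed.

Lemma near_pairs_mean W W' :
  (2 * near_pairs W W' <= 3 * (near_pairs W W + near_pairs W' W'))%N.
Proof.
rewrite -leq_sqr !expnMn; have := near_pairs_CauchySchwarz W W'; rewrite -mulnA.
have := nat_AGM2 (near_pairs W W) (near_pairs W' W').
move: ((_ + _) ^ 2)%N (near_pairs W W * _)%N (near_pairs W W' ^ 2)%N.
by move=> a b c [+ _]; lia.
Qed.

(** The near pairs are distributed among the #|I|^2 pairs of pieces, and the
    mixed pairs of pieces are controlled by the diagonal ones. *)
Lemma near_pairs_cover (I : finType) (C : I -> {set X}) W M :
    (forall x, x \in W -> exists i, x \in C i) ->
    (forall i, near_pairs (C i) (C i) <= M)%N ->
  (near_pairs W W <= 3 * #|I| ^ 2 * M)%N.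
Proof.
move=> WC CM.
have le1 : (near_pairs W W <= \sum_(i : I) \sum_(j : I) near_pairs (C i) (C j))%N.
  rewrite pair_big; apply: card_le_sum => -[x y].
  rewrite inE => /and3P[/WC[i xi] /WC[j yj] n].
  by exists (i, j); rewrite inE xi yj.
apply: leq_trans le1 _.
have -> : (3 * #|I| ^ 2 * M = \sum_(i : I) \sum_(j : I) 3 * M)%N.
  by rewrite !sum_nat_const; ring.
apply: leq_sum => i _; apply: leq_sum => j _.
rewrite -(leq_pmul2l (isT : 0 < 2)%N); apply: leq_trans (near_pairs_mean _ _) _.
by have := CM i; have := CM j; lia.
Qed.

End NearPairs.

(** * Energies of triples *)

Section Energy.
Variables (R : realType) (V : finType) (pos f : V -> R) (T : R).
Hypothesis T0 : 0 < T.
Implicit Types (A B C : {set V}).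

(** With one minus sign, a near coincidence of two triples is a near zero of
    (a - a') + (b - b') - (c - c'): all three sets enter it in the same way, as
    differences, and it can be regrouped freely. *)
Definition triple_sum (t : V * V * V) : R * R :=
  (pos t.1.1 + pos t.1.2 - pos t.2, f t.1.1 + f t.1.2 - f t.2).

Definition box A B C : {set V * V * V} :=
  [set t | [&& t.1.1 \in A, t.1.2 \in B & t.2 \in C]].

Definition energy A B C : nat :=
  near_pairs triple_sum T (box A B C) (box A B C).

(** The regroupings used below are all instances of this one: h only moves the
    six entries around without changing the difference of the two sums. *)
Let rearrange (W1 W1' W2 W2' : {set V * V * V})
    (h : (V * V * V) * (V * V * V) -> (V * V * V) * (V * V * V)) :
    injective h ->
    (forall t, t.1 \in W1 -> t.2 \in W1' -> (h t).1 \in W2 /\ (h t).2 \in W2') ->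
    (forall t, triple_sum (h t).1 - triple_sum (h t).2
             = triple_sum t.1 - triple_sum t.2) ->
  (near_pairs triple_sum T W1 W1' <= near_pairs triple_sum T W2 W2')%N.
Proof.
move=> injh hW hP; apply: (@card_le_inj _ _ h); first by move=> ? ? _ _ /injh.
move=> t; rewrite !inE hP => /and3P[t1 t2 ->].
by have [-> ->] := hW t t1 t2.
Qed.

Lemma energy_swap12 A B C : (energy A B C <= energy B A C)%N.
Proof.
pose h (t : (V * V * V) * (V * V * V)) :=
  let: ((a, b, c), (a', b', c')) := t in ((b, a, c), (b', a', c')).
apply: (@rearrange _ _ _ _ h).
- by apply: (can_inj (g := h)) => -[[[a b] c] [[a' b'] c']].
- move=> [[[a b] c] [[a' b'] c']]; rewrite !inE /=.
  by move=> /and3P[-> -> ->] /and3P[-> -> ->].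
- move=> [[[a b] c] [[a' b'] c']]; rewrite /triple_sum /=.
  by congr (_, _) => /=; ring.
Qed.

Lemma energy_swap23 A B C : (energy A B C <= energy A C B)%N.
Proof.
pose h (t : (V * V * V) * (V * V * V)) :=
  let: ((a, b, c), (a', b', c')) := t in ((a, c', b'), (a', c, b)).
apply: (@rearrange _ _ _ _ h).
- by apply: (can_inj (g := h)) => -[[[a b] c] [[a' b'] c']].
- move=> [[[a b] c] [[a' b'] c']]; rewrite !inE /=.
  by move=> /and3P[-> -> ->] /and3P[-> -> ->].
- move=> [[[a b] c] [[a' b'] c']]; rewrite /triple_sum /=.
  by congr (_, _) => /=; ring.
Qed.

(** The six points are regrouped as (a, b, b') against (a', c, c'). *)
Lemma energy_CauchySchwarz A B C :
  (energy A B C ^ 2 <= 9 * energy A B B * energy A C C)%N.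
Proof.
apply: leq_trans (near_pairs_CauchySchwarz _ T0 _ _).
rewrite leq_sqr.
pose h (t : (V * V * V) * (V * V * V)) :=
  let: ((a, b, c), (a', b', c')) := t in ((a, b, b'), (a', c, c')).
pose h' (t : (V * V * V) * (V * V * V)) :=
  let: ((a, b, b'), (a', c, c')) := t in ((a, b, c), (a', b', c')).
apply: (@rearrange _ _ _ _ h).
- by apply: (can_inj (g := h')) => -[[[a b] c] [[a' b'] c']].
- move=> [[[a b] c] [[a' b'] c']]; rewrite !inE /=.
  by move=> /and3P[-> -> ->] /and3P[-> -> ->].
- move=> [[[a b] c] [[a' b'] c']]; rewrite /triple_sum /=.
  by congr (_, _) => /=; ring.
Qed.

Lemma energy_le_card A : (energy A A A <= #|A| ^ 6)%N.
Proof.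
have -> : (#|A| ^ 6 = #|finset.setX (finset.setX (finset.setX A A) A)
                        (finset.setX (finset.setX A A) A)|)%N.
  by rewrite !cardsX; ring.
apply: subset_leq_card; apply/fintype.subsetP => -[[[a b] c] [[a' b'] c']].
by rewrite !inE /= => /and3P[/and3P[-> -> ->] /and3P[-> -> ->]].
Qed.

(** * Intervals and transversality *)

Definition short (l : R) A : Prop :=
  forall x y, x \in A -> y \in A -> `|pos x - pos y| <= l.

Definition separated (D : R) A B : Prop :=
  forall x y, x \in A -> y \in B -> D <= `|pos x - pos y|.

Lemma short_le l l' A : l <= l' -> short l A -> short l' A.
Proof. by move=> ll sA x y xA yA; apply: le_trans ll; apply: sA. Qed.

Lemma separated_sub D A B A' B' : A' \subset A -> B' \subset B ->
  separated D A B -> separated D A' B'.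
Proof.
by move=> /fintype.subsetP sA /fintype.subsetP sB s x y /sA ? /sB ?; apply: s.
Qed.

Lemma separatedC D A B : separated D A B -> separated D B A.
Proof. by move=> s x y xB yA; rewrite distrC; apply: s. Qed.

(** The windows of width 3 w overlap, so that a pair at distance at most w is
    never separated by the cutting. *)
Lemma window_cover (L w : R) A : 0 < w -> w <= L -> short L A ->
  exists m (C : 'I_m -> {set V}), [/\ m%:R <= 3 * L / w,
    forall i, C i \subset A /\ short (3 * w) (C i) &
    forall x, x \in A -> exists i, forall y, y \in A ->
      `|pos x - pos y| <= w -> y \in C i].
Proof.
move=> w0 wL sA; have [->|[a aA]] := set_0Vmem A.
  have L0 : 0 <= 3 * L / w by rewrite mulr_ge0 ?invr_ge0; lra.
  exists 0%N, (fun=> finset.set0); split => //; first by case.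
  by move=> x; rewrite inE.
pose c x := pos x - pos a + L.
have c0 x : x \in A -> 0 <= c x <= 2 * L.
  by move=> xA; have := sA x a xA aA; rewrite /c ler_norml; lra.
(* The points of A lie within L of its element a, on either side. *)
exists (Num.truncn (2 * L / w)).+1,
  (fun i => [set y in A | (i%:R - 1) * w <= c y <= (i%:R + 2) * w]); split.
- have Lw : 1 <= L / w by rewrite ler_pdivlMr ?mul1r.
  have /andP[h _] : (Num.truncn (2 * L / w))%:R <= 2 * L / w
      < (Num.truncn (2 * L / w)).+1%:R by apply: truncn_itv; rewrite -mulrA; lra.
  rewrite -natr1; move: h; rewrite -!(mulrA _ L); lra.
- move=> i; split; first by apply/fintype.subsetP => y; rewrite inE => /andP[].
  move=> x y; rewrite !inE /c => /andP[_ /andP[h1 h2]] /andP[_ /andP[h3 h4]].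
  by rewrite ler_norml; lra.
- move=> x xA; have /andP[x0 x2] := c0 _ xA.
  have lei : (Num.truncn (c x / w) < (Num.truncn (2 * L / w)).+1)%N.
    by rewrite ltnS le_truncn // ler_pM2r ?invr_gt0.
  exists (Ordinal lei) => y yA xy; rewrite inE yA /=.
  have /andP[] : (Num.truncn (c x / w))%:R <= c x / w
      < (Num.truncn (c x / w)).+1%:R by apply: truncn_itv; rewrite divr_ge0 ?(ltW w0).
  rewrite ler_pdivlMr // ltr_pdivrMr // -natr1 => h1 h2.
  by move: xy; rewrite ler_norml; move: h1 h2; rewrite /c; lra.
Qed.

(** A second derivative between 1 and 2 Lam, in a form that needs no
    derivatives: d e stands for the slope at e. Above, the distance to the
    tangent is at most quadratic; below, the slopes at distance D from e differ
    by at least D from the slope at e. *)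
Definition curved (d : V -> R) (Lam : R) : Prop :=
  (forall e y,
    `|f y - f e - d e * (pos y - pos e)| <= Lam * (pos y - pos e) ^+ 2) /\
  (forall e x x' (D : R), 0 <= D ->
    (pos e + D <= pos x /\ pos e + D <= pos x') \/
      (pos x <= pos e - D /\ pos x' <= pos e - D) ->
    D * `|pos x - pos x'| <= `|f x - f x' - d e * (pos x - pos x')|).

(** Subtract the tangent at y from f. The three other points of B contribute at
    most Lam * q ^ 2 each, while on A the resulting function has slope at least
    D in absolute value. *)
Lemma transversal_close d (Lam p q D : R) A B x y z x' y' z' :
    0 <= Lam -> curved d Lam ->
    0 <= D -> p < 2 * D -> short p A -> short q B -> separated D A B ->
    x \in A -> x' \in A -> y \in B -> z \in B -> y' \in B -> z' \in B ->
    near_zero T (triple_sum (x, y, z) - triple_sum (x', y', z')) ->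
  D * `|pos x - pos x'| <= 3 * Lam * q ^+ 2 + T.
Proof.
move=> Lam0 [curved_above curved_below] D0 pD sA sB sep.
move=> xA x'A yB zB y'B z'B /andP[/eqP /= e1 e2].
have gB u : u \in B -> `|f u - f y - d y * (pos u - pos y)| <= Lam * q ^+ 2.
  move=> uB; apply: le_trans (curved_above y u) _; apply: ler_wpM2l => //.
  by have := sB u y uB yB; rewrite ler_norml; nra.
(* A is too short for x and x' to lie on both sides of y. *)
have h1 : D * `|pos x - pos x'| <= `|f x - f x' - d y * (pos x - pos x')|.
  apply: curved_below => //; have := sA x x' xA x'A.
  have := sep x y xA yB; have := sep x' y x'A yB.
  rewrite ler_norml !ler_normr => /orP[] ? /orP[] ? ?.
  - by left; split; lra.
  - by exfalso; lra.
  - by exfalso; lra.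
  - by right; split; lra.
apply: le_trans h1 _; have -> : f x - f x' - d y * (pos x - pos x') =
   (f x + f y - f z - (f x' + f y' - f z'))
   + (f z - f y - d y * (pos z - pos y))
   + (f y' - f y - d y * (pos y' - pos y))
   - (f z' - f y - d y * (pos z' - pos y)).
  have -> : pos x = pos x' + pos y' - pos z' - pos y + pos z by lra.
  by ring.
have := gB z zB; have := gB y' y'B; have := gB z' z'B; move: e2.
by rewrite !ler_norml; lra.
Qed.
End Energy.

(** * The bilinear iteration *)

Section Iteration.
Variables (R : realType) (V : finType) (pos f : V -> R) (T : R).
Hypothesis T0 : 0 < T.
Variables (d : V -> R) (Lam : R).
Hypothesis Lam0 : 0 <= Lam.
Hypothesis crv : curved pos f d Lam.
Implicit Types (A B C : {set V}).
Local Notation E A B C := (energy pos f T A B C).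

(** Both points of A lie in one window, so that cutting A costs only the number
    of windows and not its square. *)
Lemma transversal_refine (p q D w M : R) A B :
    0 < D -> p < 2 * D -> 0 < w -> w <= p -> 3 * Lam * q ^+ 2 + T <= D * w ->
    short pos p A -> short pos q B -> separated pos D A B ->
    (forall A', A' \subset A -> short pos (3 * w) A' -> (E A' B B)%:R <= M) ->
  (E A B B)%:R <= 3 * p / w * M.
Proof.
move=> D0 pD w0 wp qw sA sB sep AM.
have [m [C [mle CA CC]]] := window_cover w0 wp sA.
have le1 : (E A B B <= \sum_(i < m) E (C i) B B)%N.
  apply: card_le_sum => -[[[x y] z] [[x' y'] z']]; rewrite !inE /=.
  move=> /and3P[/and3P[xA yB zB] /and3P[x'A y'B z'B] n].
  have [i iC] := CC x xA; exists i; rewrite !inE /= yB zB y'B z'B n !andbT.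
  rewrite !iC ?subrr ?normr0 ?(ltW w0) // -(ler_pM2l D0); apply: le_trans qw.
  have close := transversal_close Lam0 crv (ltW D0) pD.
  exact: (close T q A B x y z x' y' z').
apply: (@le_trans _ _ (\sum_(i < m) (E (C i) B B)%:R)).
  by rewrite -natr_sum ler_nat.
apply: (@le_trans _ _ (\sum_(i < m) M)).
  by apply: ler_sum => i _; have [? ?] := CA i; apply: AM.
rewrite sumr_const card_ord -[M *+ m]mulr_natl; apply: ler_wpM2r => //.
apply: le_trans (AM finset.set0 _ _); rewrite ?ler0n ?finset.sub0set //.
by move=> x y; rewrite inE.
Qed.

(** The new set is repeated instead of the old one, which prepares the next use
    of transversal_refine with the two sets exchanged. *)
Lemma energy_exchange A B : ((E A B B)%:R ^+ 2 : R)
  <= 9 * (E B A A)%:R * (E B B B)%:R.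
Proof.
have := leq_trans (leq_mul (energy_swap12 pos f T A B B)
  (energy_swap12 pos f T A B B)) (energy_CauchySchwarz pos f T0 B A B).
by rewrite -(ler_nat R) !natrM.
Qed.

(** Two exchanges lead back to the same quantity. *)
Lemma energy_interpolation A B (M : R) :
  (E A A A)%:R <= M -> (E B B B)%:R <= M -> (E A B B)%:R <= 9 * M.
Proof.
have := energy_exchange A B; have := energy_exchange B A.
have := ler0n R (E A B B); have := ler0n R (E B A A).
have := ler0n R (E A A A); have := ler0n R (E B B B).
move: (E A B B)%:R (E B A A)%:R (E A A A)%:R (E B B B)%:R => x y a b.
move=> b0 a0 y0 x0 hy hx aM bM.
rewrite leNgt; apply/negP => Mx; have [xy|yx] := lerP x y.
  have : 9 * x * a <= 9 * y * M by apply: ler_pM; lra.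
  by nra.
have : 9 * y * b <= 9 * x * M by apply: ler_pM; lra.
by nra.
Qed.

(** Write X for a * L ^ (3 + eta). One round cuts A, of length L t / kappa,
    into about t^-3 windows of length L t^4 / kappa; an exchange then gives the
    square root of [ X (t^2)^(eta r) ] * [ X t^6 (t^2)^eta ], where the first
    factor is the previous round at t^2 and the second one is the induction on
    scales at the length of B. Thus t^-3 cancels t^3, and t^eta is gained. The
    constant 729 is the fixed point of 27 * sqrt _, where 27 = 9 * 3 comes from
    the number of windows and from the exchange. *)
Lemma bilinear_iteration (L kappa D eta a : R) r (t : R) A B :
    0 < L -> 0 < D -> 2 <= kappa -> L < 2 * D * kappa ->
    3 * (3 * Lam + T) * L <= kappa * D -> 0 < eta -> 0 <= a ->
    (forall (l : R) S, 1 <= l -> l <= L / 2 ->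
       short pos l S -> (E S S S)%:R <= a * l `^ (3 + eta)) -> 0 < t -> t <= 1 ->
    kappa <= L * t ^+ (2 ^ r) ->
    short pos (L * t / kappa) A -> short pos (L * t ^+ 2 / kappa) B ->
    separated pos D A B ->
  (E A B B)%:R <= 729 * (a * L `^ (3 + eta)) * (t `^ eta) ^+ r.
Proof.
move=> L0 D0 kappa2 D_big kappa_big eta0 a0 smaller_scales.
set X := a * _.
have X0 : 0 <= X by rewrite mulr_ge0 // powR_ge0.
have k0 : 0 < kappa by lra.
(* The induction on scales at length L * l / kappa, relative to X. *)
have single (l : R) S : 0 < l -> l <= 1 -> kappa <= L * l ->
    short pos (L * l / kappa) S -> (E S S S)%:R <= X * (l ^+ 3 * l `^ eta).
  move=> l0 l1 kl sS; have Ll0 : 0 < L * l by rewrite mulr_gt0.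
  have := smaller_scales (L * l / kappa) S.
  rewrite ler_pdivlMr // mul1r => /(_ kl).
  have -> : L * l / kappa <= L / 2 by rewrite ler_pdivrMr //; nra.
  move=> /(_ isT sS) /le_trans; apply; rewrite /X -[leRHS]mulrA ler_wpM2l //.
  have -> : l ^+ 3 * l `^ eta = l `^ (3 + eta).
    by rewrite powRD ?powR_mulrn ?(ltW l0) // (gt_eqF l0) implybT.
  rewrite -powRM ?(ltW L0) ?(ltW l0) //; apply: ge0_ler_powR.
  - by lra.
  - by rewrite nnegrE divr_ge0 ?(ltW k0) ?(ltW Ll0).
  - by rewrite nnegrE (ltW Ll0).
  - by rewrite ler_pdivrMr // ler_peMr ?(ltW Ll0) //; lra.
elim: r t A B => [|r IHr] t A B t0 t1 kt sA sB sep.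
  rewrite expr0 mulr1; apply: (@le_trans _ _ (9 * X)); last by nra.
  rewrite expn0 expr1 in kt.
  have tX : X * (t ^+ 3 * t `^ eta) <= X.
    apply: ler_piMr => //; apply: mulr_ile1; rewrite ?powR_ge0 ?exprn_ge0 ?(ltW t0) //.
      by rewrite exprn_ile1 // ltW.
    have := ge0_ler_powR (ltW eta0) _ _ t1.
    by rewrite !nnegrE ltW // powR1 => ->; rewrite ?ler01.
  apply: energy_interpolation; apply: le_trans tX; apply: single => //.
  apply: short_le sB; rewrite ler_pM2r ?invr_gt0 // ler_pM2l //.
  by rewrite ger_pMr.
have t20 : 0 < t ^+ 2 by rewrite exprn_gt0.
have t21 : t ^+ 2 <= 1 by rewrite exprn_ile1 // ltW.
have kt2 : kappa <= L * (t ^+ 2) ^+ (2 ^ r) by rewrite -exprM -expnS.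
have kt1 : kappa <= L * t ^+ 2.
  apply: le_trans kt2 _; rewrite ler_pM2l // -{2}[t ^+ 2]expr1.
  by apply: ler_wiXn2l; rewrite ?(ltW t20) // expn_gt0.
pose q := L * t ^+ 2 / kappa.
have q1 : 1 <= q by rewrite /q ler_pdivlMr ?mul1r.
pose w := L * (t ^+ 2) ^+ 2 / kappa / 3.
pose h := t `^ eta.
have h0 : 0 <= h by apply: powR_ge0.
have h2 : (t ^+ 2) `^ eta = h ^+ 2 by rewrite expr2 powRM ?ltW // -expr2.
have refined A' : A' \subset A -> short pos (3 * w) A' ->
    (E A' B B)%:R <= 81 * (X * h ^+ r.+1 * t ^+ 3).
  move=> sA' shA'.
  have w3 : 3 * w = L * (t ^+ 2) ^+ 2 / kappa by rewrite /w; field; rewrite gt_eqF.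
  have := IHr _ B A' t20 t21 kt2 sB; rewrite -w3 h2 => /(_ shA').
  move=> /(_ (separatedC (separated_sub sA' (fintype.subxx _) sep))) e1.
  have := single _ _ t20 t21 kt1 sB; rewrite h2 => e2.
  have M0 : 0 <= 81 * (X * h ^+ r.+1 * t ^+ 3).
    by rewrite mulr_ge0 // mulr_ge0 ?exprn_ge0 ?(ltW t0) // mulr_ge0 ?exprn_ge0.
  rewrite -(@ler_pXn2r _ 2) ?nnegrE ?ler0n //.
  apply: le_trans (energy_exchange _ _) _; rewrite -mulrA.
  have -> : (81 * (X * h ^+ r.+1 * t ^+ 3)) ^+ 2 =
      9 * ((729 * X * (h ^+ 2) ^+ r) * (X * ((t ^+ 2) ^+ 3 * h ^+ 2))).
    by rewrite [(h ^+ 2) ^+ r]exprAC [h ^+ r.+1]exprS; ring.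
  by rewrite ler_wpM2l //; apply: ler_pM.
have w0 : 0 < w by rewrite /w !divr_gt0 ?mulr_gt0 ?exprn_gt0.
have p_w : L * t / kappa = 3 * w / t ^+ 3.
  by rewrite /w; field; rewrite ?gt_eqF.
have t31 : t ^+ 3 <= 1 by rewrite exprn_ile1 // ltW.
have t30 : 0 < t ^+ 3 by rewrite exprn_gt0.
have := @transversal_refine (L * t / kappa) q D w _ A B D0 _ w0 _ _ sA sB sep refined.
have -> : 3 * (L * t / kappa) / w * (81 * (X * h ^+ r.+1 * t ^+ 3))
    = 729 * X * h ^+ r.+1.
  by rewrite p_w; field; rewrite ?gt_eqF.
apply.
- by rewrite ltr_pdivrMr //; nra.
- by rewrite p_w ler_pdivlMr //; nra.
- have Tp := T0; have Lamp := Lam0; have q2 : 1 <= q ^+ 2 by rewrite exprn_ege1.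
  have Dw : D * w = q ^+ 2 * (kappa * D / (3 * L)).
    by rewrite /w /q; field; rewrite ?gt_eqF.
  apply: (@le_trans _ _ (q ^+ 2 * (3 * Lam + T))); first by nra.
  rewrite Dw; apply: ler_wpM2l; first by lra.
  by rewrite ler_pdivlMr ?mulr_gt0 //; nra.
Qed.
End Iteration.

(** * Broad and narrow triples *)

Section BroadNarrow.
Variables (R : realType) (V : finType) (pos f : V -> R) (T : R).
Hypothesis T0 : 0 < T.
Implicit Types (A B C : {set V}).
Local Notation E A B C := (energy pos f T A B C).
Local Notation short := (short pos).
Local Notation separated := (separated pos).

Definition narrow (rho : R) (t : V * V * V) : bool :=
  [&& `|pos t.1.1 - pos t.1.2| <= rho, `|pos t.1.1 - pos t.2| <= rho
    & `|pos t.1.2 - pos t.2| <= rho].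

Lemma pivot_energy (M D l : R) A B C :
    (forall A B, short l A -> short l B -> separated D A B ->
       (E A B B)%:R <= M) ->
    short l A -> short l B -> short l C -> separated D A B -> separated D A C ->
  (E A B C)%:R <= 3 * M.
Proof.
move=> bil sA sB sC sAB sAC.
have eB := bil A B sA sB sAB; have eC := bil A C sA sC sAC.
have M0 : 0 <= M by apply: le_trans eB; apply: ler0n.
rewrite -(@ler_pXn2r _ 2) ?nnegrE ?ler0n //; last by lra.
have := energy_CauchySchwarz pos f T0 A B C; rewrite -(ler_nat R) !natrM.
move=> /le_trans; apply; rewrite exprMn expr2 -mulrA.
have -> : 3 * 3 * M ^+ 2 = 9 * (M * M) by ring.
by rewrite ler_wpM2l // ler_pM ?ler0n.
Qed.

Lemma far_separated (rho D l : R) A B x y : 2 * D + 4 * l <= rho ->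
  short l A -> short l B -> x \in A -> y \in B -> rho / 2 < `|pos x - pos y| ->
  separated D A B.
Proof.
move=> Dl sA sB xA yB; rewrite ltr_normr => xy x' y' x'A y'B.
have := sA x x' xA x'A; have := sB y y' yB y'B; rewrite !ler_norml => ? ?.
rewrite ler_normr; case/orP: xy => ?; apply/orP; [left|right]; lra.
Qed.

(** If two of three points differ by more than rho, the third one is at more
    than rho / 2 from one of them, which is then far from both other points. *)
Lemma broad_energy (M D l rho : R) A B C t : 2 * D + 4 * l <= rho ->
    (forall A B, short l A -> short l B -> separated D A B ->
       (E A B B)%:R <= M) ->
    short l A -> short l B -> short l C -> t \in box A B C -> ~~ narrow rho t ->
  (E A B C)%:R <= 3 * M.
Proof.
case: t => [[x y] z] Dl bil sA sB sC; rewrite inE /= => /and3P[xA yB zC] far.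
have far2 : [\/ rho / 2 < `|pos x - pos y| /\ rho / 2 < `|pos x - pos z|,
    rho / 2 < `|pos y - pos x| /\ rho / 2 < `|pos y - pos z|
  | rho / 2 < `|pos z - pos x| /\ rho / 2 < `|pos z - pos y|].
  have h1 := ler_distD (pos z) (pos x) (pos y).
  have h2 := ler_distD (pos y) (pos x) (pos z).
  have h3 := ler_distD (pos x) (pos y) (pos z).
  move: far h1 h2 h3; rewrite /narrow /= !negb_and -!ltNge.
  rewrite [ `|pos y - pos x| ]distrC [ `|pos z - pos x| ]distrC.
  rewrite [ `|pos z - pos y| ]distrC.
  move: `|pos x - pos y| `|pos x - pos z| `|pos y - pos z| => u v w far h1 h2 h3.
  have [?|?] := ltP (rho / 2) u; have [?|?] := ltP (rho / 2) v;
    have [?|?] := ltP (rho / 2) w; try by [constructor 1|constructor 2|constructor 3];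
    exfalso; move: far => /orP[?|/orP[?|?]]; lra.
case: far2 => -[d1 d2].
- apply: (pivot_energy bil sA sB sC).
    exact: far_separated Dl sA sB xA yB d1.
  exact: far_separated Dl sA sC xA zC d2.
- apply: (@le_trans _ _ (E B A C)%:R); first by rewrite ler_nat energy_swap12.
  apply: (pivot_energy bil sB sA sC).
    exact: far_separated Dl sB sA yB xA d1.
  exact: far_separated Dl sB sC yB zC d2.
- apply: (@le_trans _ _ (E C A B)%:R).
    rewrite ler_nat; apply: leq_trans (energy_swap23 _ _ _ _ _ _) _.
    exact: energy_swap12.
  apply: (pivot_energy bil sC sA sB).
    exact: far_separated Dl sC sA zC xA d1.
  exact: far_separated Dl sC sB zC yB d2.
Qed.

(** Narrow triples are covered by the cubes of O(L / rho) windows only, so they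
    cost (L / rho)^2 instead of the (L / rho)^6 of a decomposition into boxes.
    The broad ones are split into all boxes of side l, as any loss that is
    polynomial in L / l is acceptable for them. *)
Lemma broad_narrow_energy (L rho l D Mn Mb : R) A :
    0 < rho -> rho <= L -> 0 < l -> l <= L -> 2 * D + 4 * l <= rho ->
    short L A ->
    (forall S, short (3 * rho) S -> (E S S S)%:R <= Mn) ->
    (forall A B, short l A -> short l B -> separated D A B ->
       (E A B B)%:R <= Mb) ->
  (E A A A)%:R <= 12 * Num.max (27 * (L / rho) ^+ 2 * Mn)
                               (9 * (9 * (L / l)) ^+ 6 * Mb).
Proof.
move=> rho0 rhoL l0 lL Dl sA nar bil.
have Mn0 : 0 <= Mn.
  apply: le_trans (nar finset.set0 _); rewrite ?ler0n // => x y.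
  by rewrite inE.
have Mb0 : 0 <= Mb.
  apply: le_trans (bil finset.set0 finset.set0 _ _ _);
    by rewrite ?ler0n // => x y; rewrite inE.
pose Wn := [set t in box A A A | narrow rho t].
pose Wb := [set t in box A A A | ~~ narrow rho t].
have cover_le (I : finType) (C : I -> {set V * V * V})
      (W : {set V * V * V}) (M : R) : 0 <= M ->
    (forall t, t \in W -> exists i, t \in C i) ->
    (forall i, (near_pairs (triple_sum pos f) T (C i) (C i))%:R <= M) ->
    (near_pairs (triple_sum pos f) T W W)%:R <= 3 * #|I|%:R ^+ 2 * M.
  move=> M0 WC CM; pose n := Num.trunc M.
  have CM' i : (near_pairs (triple_sum pos f) T (C i) (C i) <= n)%N.
    by rewrite truncn_ge_nat.
  have := near_pairs_cover T0 WC CM'; rewrite -(ler_nat R) !natrM -expr2.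
  by move=> /le_trans; apply; rewrite ler_wpM2l ?mulr_ge0 ?exprn_ge0 ?truncn_le.
have nearWn : (near_pairs (triple_sum pos f) T Wn Wn)%:R
    <= 27 * (L / rho) ^+ 2 * Mn.
  have [m [C [mle CA CC]]] := window_cover rho0 rhoL sA.
  apply: (@le_trans _ _ (3 * m%:R ^+ 2 * Mn)).
    rewrite -[m]card_ord.
    apply: (cover_le _ (fun i => box (C i) (C i) (C i))) => // [|i]; last first.
      by apply: nar; have [] := CA i.
    move=> [[x y] z]; rewrite !inE /= => /andP[/and3P[xA yA zA] /and3P[xy xz yz]].
    have [i iC] := CC x xA; exists i; rewrite !inE /= !iC ?subrr ?normr0 ?(ltW rho0) //.
  apply: ler_wpM2r => //; have m0 : 0 <= m%:R :> R by [].
  have : m%:R ^+ 2 <= (3 * L / rho) ^+ 2.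
    by rewrite ler_pXn2r // nnegrE; apply: le_trans mle.
  by rewrite -mulrA exprMn; lra.
have nearWb : (near_pairs (triple_sum pos f) T Wb Wb)%:R
    <= 9 * (9 * (L / l)) ^+ 6 * Mb.
  have l30 : 0 < l / 3 by lra.
  have l3L : l / 3 <= L by lra.
  have [m [C [mle CA CC]]] := window_cover l30 l3L sA.
  have sC i : short l (C i).
    by apply: short_le (CA i).2; lra.
  apply: (@le_trans _ _ (3 * (m%:R * m%:R * m%:R) ^+ 2 * (3 * Mb))).
    have -> : m%:R * m%:R * m%:R = #|{: 'I_m * 'I_m * 'I_m}|%:R :> R.
      by rewrite !card_prod !card_ord !natrM.
    apply: (cover_le _ (fun i => Wb :&: box (C i.1.1) (C i.1.2) (C i.2))).
    - by lra.
    - move=> t tW; move: (tW); rewrite !inE => /andP[/and3P[t1 t2 t3] _].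
      have [i iC] := CC _ t1; have [j jC] := CC _ t2; have [k kC] := CC _ t3.
      exists (i, j, k); rewrite inE tW !inE /=.
      by rewrite iC ?jC ?kC ?subrr ?normr0 ?(ltW l30).
    - move=> [[i j] k] /=; set W := (_ :&: _).
      have [->|[t]] := set_0Vmem W.
        rewrite near_pairsE big1 ?mulr_ge0 // => t; by rewrite inE.
      rewrite !inE => /andP[/andP[_ far] tC].
      apply: le_trans (broad_energy Dl bil (sC i) (sC j) (sC k) _ far); last first.
        by rewrite inE.
      by rewrite ler_nat; apply: near_pairs_sub; apply: finset.subsetIr.
  have m0 : 0 <= m%:R :> R by [].
  have m6 : m%:R ^+ 6 <= (9 * (L / l)) ^+ 6.
    rewrite ler_pXn2r ?nnegrE //; last first.
      by rewrite mulr_ge0 // divr_ge0 //; lra.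
    by apply: le_trans mle _; rewrite invf_div; lra.
  have -> : 3 * (m%:R * m%:R * m%:R) ^+ 2 * (3 * Mb) = 9 * m%:R ^+ 6 * Mb by ring.
  by rewrite ler_wpM2r // ler_wpM2l.
(* The factor 12 is 3 * 2 ^ 2, for the covering of all triples by two sets. *)
pose M := Num.max (27 * (L / rho) ^+ 2 * Mn) (9 * (9 * (L / l)) ^+ 6 * Mb).
have -> : 12 * M = 3 * #|{: bool}|%:R ^+ 2 * M by rewrite card_bool; ring.
apply: (cover_le _ (fun b : bool => if b then Wn else Wb)).
- by rewrite le_max mulr_ge0 // mulr_ge0 // exprn_ge0 // divr_ge0 //; lra.
- move=> t tA; exists (narrow rho t).
  by case: ifP => nt; rewrite inE tA nt.
- by case; rewrite le_max ?nearWn ?nearWb ?orbT.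
Qed.

End BroadNarrow.

(** * Induction on scales *)

(** Narrow triples lose 12 * 729 / K. For the broad ones, 729 X t^13 comes from
    the bilinear iteration, and t^-12 from cutting into boxes of side L t^2 /
    kappa: one factor t remains to absorb all constants. *)
Lemma energy_descent (R : realType) (V : finType) (pos f d : V -> R)
    (T Lam K kappa t eta a L : R) (r : nat) (A : {set V}) :
    0 < T -> 0 <= Lam -> curved pos f d Lam -> 0 < eta -> 0 <= a ->
    12 * 729 <= K -> 8 * K <= kappa -> 12 * K * (3 * Lam + T) <= kappa ->
    0 < t -> t <= 1 -> (t `^ eta) ^+ r <= t ^+ 13 ->
    12 * 9 * 729 * (9 * kappa) ^+ 6 * t <= 1 -> kappa <= L * t ^+ (2 ^ r) ->
    (forall (l : R) S, 1 <= l -> l <= L / 2 -> short pos l S ->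
       (energy pos f T S S S)%:R <= a * l `^ (3 + eta)) ->
    short pos L A ->
  (energy pos f T A A A)%:R <= a * L `^ (3 + eta).
Proof.
move=> T0 Lam0 crv eta0 a0 Kbig kK kS t0 t1 tr ct kL IH sA.
have K1 : 12 <= K by lra.
have K0 : 0 < K by lra.
have k0 : 0 < kappa by lra.
have t2 : 0 < t ^+ 2 by rewrite exprn_gt0.
have kL' : kappa <= L.
  have tr0 : 0 < t ^+ (2 ^ r) by rewrite exprn_gt0.
  have Lp : 0 < L by rewrite -(pmulr_lgt0 _ tr0); apply: lt_le_trans kL.
  by apply: le_trans kL _; rewrite ler_piMr ?(ltW Lp) // exprn_ile1 // ltW.
have L0 : 0 < L by lra.
pose X := a * L `^ (3 + eta).
have X0 : 0 <= X by rewrite mulr_ge0 // powR_ge0.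
pose rho := L / K; pose D := rho / 4; pose l := L * t ^+ 2 / kappa.
have LrhoK : L = rho * K by rewrite /rho divfK // gt_eqF //; lra.
have rho0 : 0 < rho by rewrite divr_gt0 //; lra.
have rho1 : 1 <= rho by rewrite ler_pdivlMr; lra.
have D0 : 0 < D by rewrite /D; lra.
have l0 : 0 < l by rewrite divr_gt0 ?mulr_gt0.
have lr : l <= rho / 8.
  rewrite /l ler_pdivrMr // LrhoK; apply: (@le_trans _ _ (rho * K)).
    by rewrite ler_piMr ?exprn_ile1 ?(ltW t0) // mulr_ge0 //; lra.
  by have := ler_wpM2l (ltW rho0) kK; lra.
have rhoL : rho <= L by rewrite LrhoK ler_peMr; lra.
have bil A' B' : short pos l A' -> short pos l B' -> separated pos D A' B' ->
    (energy pos f T A' B' B')%:R <= 729 * X * t ^+ 13.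
  move=> sA' sB' sep; apply: (@le_trans _ _ (729 * X * (t `^ eta) ^+ r)).
    apply: (bilinear_iteration T0 Lam0 crv (L := L) (kappa := kappa) (D := D)) => //.
    - by lra.
    - have -> : 2 * D * kappa = rho * (kappa / 2) by rewrite /D; lra.
      by rewrite LrhoK ltr_pM2l //; lra.
    - have -> : kappa * D = rho * (kappa / 4) by rewrite /D; lra.
      have -> : 3 * (3 * Lam + T) * L = rho * (3 * (K * (3 * Lam + T))).
        by rewrite LrhoK; ring.
      by rewrite ler_pM2l //; lra.
    - apply: short_le sA'; rewrite /l ler_pM2r ?invr_gt0 // ler_pM2l //.
      by rewrite expr2 ler_piMr // ltW.
  by apply: ler_wpM2l tr; apply: mulr_ge0 X0; apply: ler0n.
have nar S : short pos (3 * rho) S ->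
    (energy pos f T S S S)%:R <= X * (3 / K) ^+ 3.
  move=> sS; apply: (@le_trans _ _ (a * (3 * rho) `^ (3 + eta))).
    apply: IH => //; last by rewrite LrhoK; nra.
    by lra.
  have K3 : 0 < 3 / K by rewrite divr_gt0 //; lra.
  have -> : 3 * rho = 3 / K * L by rewrite /rho; ring.
  rewrite powRM ?(ltW K3) ?(ltW L0) // [leLHS]mulrCA -/X [leLHS]mulrC ler_wpM2l //.
  have -> : (3 / K) ^+ 3 = (3 / K) `^ 3 by rewrite powR_mulrn // ltW.
  apply: ger_powR; last by lra.
  by rewrite K3 ler_pdivrMr; lra.
apply: le_trans (broad_narrow_energy T0 rho0 rhoL l0 _ _ sA nar bil) _.
- by lra.
- by rewrite /D; lra.
rewrite -/X maxr_pMr // ge_max; apply/andP; split.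
  have -> : 12 * (27 * (L / rho) ^+ 2 * (X * (3 / K) ^+ 3)) = 12 * 729 / K * X.
    by rewrite LrhoK; field; rewrite !gt_eqF //; lra.
  by apply: ler_piMl X0 _; rewrite (ler_pdivrMr _ _ K0) mul1r.
have -> : 12 * (9 * (9 * (L / l)) ^+ 6 * (729 * X * t ^+ 13))
    = 12 * 9 * 729 * (9 * kappa) ^+ 6 * t * X.
  have -> : L / l = kappa / t ^+ 2 by rewrite /l; field; rewrite !gt_eqF.
  have -> : t ^+ 13 = t * (t ^+ 2) ^+ 6 by ring.
  rewrite mulrA [9 * (kappa / _)]mulrA expr_div_n.
  move: ((9 * kappa) ^+ 6) ((t ^+ 2) ^+ 6) (exprn_gt0 6 t2) => u v v0.
  by field; rewrite gt_eqF.
by apply: ler_piMl X0 ct.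
Qed.

(** The number r of rounds makes (t^eta)^r smaller than t^13. Below the scale
    L0 where the iteration is not available, a is chosen so large that the
    trivial bound suffices. *)
Lemma energy_bound (R : realType) (Lam T eta : R) :
    0 <= Lam -> 0 < T -> 0 < eta ->
  exists a : R, forall (V : finType) (pos f d : V -> R),
    (forall (l : R) A, 0 <= l -> short pos l A -> #|A|%:R <= l + 1) ->
    curved pos f d Lam ->
    forall L A, 1 <= L -> short pos L A ->
      (energy pos f T A A A)%:R <= a * L `^ (3 + eta).
Proof.
move=> Lam0 T0 eta0.
have [K K1 Kbig] : exists2 K : R, 1 <= K & 12 * 729 <= K.
  by exists (12 * 729); lra.
pose kappa : R := 8 * K + 12 * K * (3 * Lam + T).
have KS0 : 0 <= 12 * K * (3 * Lam + T) by rewrite !mulr_ge0 //; lra.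
have kK : 8 * K <= kappa by rewrite lerDl.
have kS : 12 * K * (3 * Lam + T) <= kappa by rewrite lerDr; lra.
have [t [t0 t1 ct]] : exists t : R,
    [/\ 0 < t, t <= 1 & 12 * 9 * 729 * (9 * kappa) ^+ 6 * t <= 1].
  have : 1 <= 12 * 9 * 729 * (9 * kappa) ^+ 6.
    have k6 : 1 <= (9 * kappa) ^+ 6 by rewrite exprn_ege1 //; lra.
    by lra.
  move: (12 * 9 * 729 * (9 * kappa) ^+ 6) => c c1; exists c^-1.
  have c0 : 0 < c by lra.
  by rewrite invr_gt0 invf_le1 ?divff ?gt_eqF.
pose r := (Num.trunc (13 / eta)).+1.
pose L0 : R := kappa / t ^+ (2 ^ r).
pose a : R := (L0 + 1) ^+ 6.
have tr : (t `^ eta) ^+ r <= t ^+ 13.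
  rewrite -powR_mulrn ?powR_ge0 // -powRrM -powR_mulrn ?(ltW t0) //.
  apply: ger_powR; first by rewrite t0.
  have := truncnS_gt (13 / eta); rewrite -/r ltr_pdivrMr // mulrC.
  exact: ltW.
have tr0 : 0 < t ^+ (2 ^ r) by rewrite exprn_gt0.
have L01 : 1 <= L0.
  apply: (@le_trans _ _ kappa); first by lra.
  by rewrite ler_pdivlMr // ler_piMr ?exprn_ile1 ?(ltW t0) //; lra.
exists a => V pos f d spaced crv.
have small L A : 1 <= L -> L <= L0 -> short pos L A ->
    (energy pos f T A A A)%:R <= a * L `^ (3 + eta).
  move=> L1 LL0 sA; apply: (@le_trans _ _ a).
    apply: (@le_trans _ _ (#|A| ^ 6)%:R); first by rewrite ler_nat energy_le_card.
    rewrite natrX lerXn2r ?nnegrE //; first by lra.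
    by apply: le_trans (spaced L A _ sA) _; lra.
  by rewrite ler_peMr ?exprn_ge0 // -?[leLHS](powRr0 L) ?ler_powR //; lra.
have ind n : forall L A, 1 <= L -> L <= 2 ^+ n -> short pos L A ->
    (energy pos f T A A A)%:R <= a * L `^ (3 + eta).
  elim: n => [|n IHn] L A L1 Ln sA.
    by apply: small => //; rewrite expr0 in Ln; lra.
  have [LL0|LL0] := lerP L L0; first exact: small.
  apply: (energy_descent T0 Lam0 crv eta0 _ Kbig kK kS t0 t1 tr ct _ _ sA) => //.
  - by rewrite exprn_ge0 //; lra.
  - by rewrite -ler_pdivrMr // ltW.
  - by move=> l S l1 lL; apply: IHn => //; rewrite exprS in Ln; lra.
move=> L A L1 sA; apply: (ind (Num.trunc L).+1) => //.
apply: (@le_trans _ _ (Num.trunc L).+1%:R); first by rewrite ltW // truncnS_gt.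
by rewrite -natrX ler_nat ltnW // ltn_expl.
Qed.

(** * Powers have curved graphs *)

(** By induction on m, since x^(m+1) - e^(m+1) - (m+1) e^m (x - e) is x times
    the same expression for m, plus m e^(m-1) (x - e)^2. *)
Lemma pow_tangent (R : realFieldType) (b e x : R) (m : nat) :
    0 <= e <= b -> 0 <= x <= b ->
  0 <= x ^+ m.+2 - e ^+ m.+2 - m.+2%:R * e ^+ m.+1 * (x - e)
    <= m.+2%:R ^+ 2 * b ^+ m * (x - e) ^+ 2.
Proof.
move=> /andP[e0 eb] /andP[x0 xb]; have b0 : 0 <= b by lra.
have sq0 : 0 <= (x - e) ^+ 2 by rewrite sqr_ge0.
elim: m => [|m /andP[IH0 IH1]]; first by rewrite expr0 expr1; apply/andP; split; nra.
set u := _ - _ - _ in IH0 IH1.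
have -> : x ^+ m.+3 - e ^+ m.+3 - m.+3%:R * e ^+ m.+2 * (x - e)
    = x * u + m.+2%:R * e ^+ m.+1 * (x - e) ^+ 2.
  by rewrite /u -[m.+3%:R]natr1 !exprS; ring.
have xu : x * u <= b * (m.+2%:R ^+ 2 * b ^+ m * (x - e) ^+ 2) by apply: ler_pM.
have ebm : e ^+ m.+1 <= b ^+ m.+1 by rewrite lerXn2r ?nnegrE.
have m0 : 1 <= m.+2%:R :> R by rewrite ler1n.
have em0 : 0 <= e ^+ m.+1 by rewrite exprn_ge0.
have t2 : m.+2%:R * e ^+ m.+1 * (x - e) ^+ 2
    <= m.+2%:R * (b * b ^+ m) * (x - e) ^+ 2.
  by rewrite ler_wpM2r // ler_wpM2l ?ler0n // -exprS.
apply/andP; split.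
  apply: addr_ge0; first exact: mulr_ge0.
  by apply: mulr_ge0 sq0; rewrite mulr_ge0 ?ler0n.
apply: le_trans (lerD xu t2) _.
rewrite [b ^+ m.+1]exprS -[m.+3%:R]natr1.
have -> : b * (m.+2%:R ^+ 2 * b ^+ m * (x - e) ^+ 2)
    + m.+2%:R * (b * b ^+ m) * (x - e) ^+ 2
  = (m.+2%:R ^+ 2 + m.+2%:R) * (b * b ^+ m) * (x - e) ^+ 2 by ring.
rewrite ler_wpM2r // ler_wpM2r ?mulr_ge0 ?exprn_ge0 //; nra.
Qed.

Lemma pow_increment (R : realFieldType) (a e x : R) (m : nat) :
  0 <= a -> a <= e -> e <= x -> (x - e) * a ^+ m <= x ^+ m.+1 - e ^+ m.+1.
Proof.
move=> a0 ae ex; elim: m => [|m IH]; first by rewrite expr0 mulr1.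
have e0 : 0 <= e by lra.
have -> : x ^+ m.+2 - e ^+ m.+2
    = (x - e) * x ^+ m.+1 + e * (x ^+ m.+1 - e ^+ m.+1) by rewrite !exprS; ring.
have h1 : e ^+ m.+1 <= x ^+ m.+1 by rewrite lerXn2r ?nnegrE //; lra.
have h2 : a ^+ m.+1 <= x ^+ m.+1 by rewrite lerXn2r ?nnegrE //; lra.
by nra.
Qed.

(** For the lower bound, convexity replaces the chord from x to x' by the
    tangent at whichever of the two is closer to e, and pow_increment compares
    its slope with the slope at e. *)
Lemma pow_curved (R : realType) (V : finType) (pos : V -> R) (a b : R) (m : nat) :
    0 < a -> (forall v, a <= pos v <= b) ->
  curved pos (fun v => pos v ^+ m.+2 / a ^+ m)
    (fun v => m.+2%:R * pos v ^+ m.+1 / a ^+ m) (m.+2%:R ^+ 2 * (b / a) ^+ m).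
Proof.
move=> a0 ab; have am : 0 < a ^+ m by rewrite exprn_gt0.
have posb v : 0 <= pos v <= b by have := ab v; lra.
split=> [e y|e x x' D D0 side].
  have /andP[h0 h1] := pow_tangent m (posb e) (posb y).
  have -> : pos y ^+ m.+2 / a ^+ m - pos e ^+ m.+2 / a ^+ m
      - m.+2%:R * pos e ^+ m.+1 / a ^+ m * (pos y - pos e)
    = (pos y ^+ m.+2 - pos e ^+ m.+2 - m.+2%:R * pos e ^+ m.+1 * (pos y - pos e))
      / a ^+ m by field; rewrite gt_eqF.
  rewrite ger0_norm ?divr_ge0 ?(ltW am) // ler_pdivrMr // expr_div_n.
  have -> // : m.+2%:R ^+ 2 * (b ^+ m / a ^+ m) * (pos y - pos e) ^+ 2 * a ^+ m =
    m.+2%:R ^+ 2 * b ^+ m * (pos y - pos e) ^+ 2.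
  by field; rewrite gt_eqF.
have -> : pos x ^+ m.+2 / a ^+ m - pos x' ^+ m.+2 / a ^+ m
      - m.+2%:R * pos e ^+ m.+1 / a ^+ m * (pos x - pos x')
    = (pos x ^+ m.+2 - pos x' ^+ m.+2
       - m.+2%:R * pos e ^+ m.+1 * (pos x - pos x')) / a ^+ m by field; rewrite gt_eqF.
rewrite normrM [ `|(a ^+ m)^-1|]gtr0_norm ?invr_gt0 // ler_pdivlMr //.
wlog xx : x x' side / pos x' <= pos x => [wl|].
  have [|xx] := leP (pos x') (pos x); first exact: wl.
  rewrite [ `|pos x - _|]distrC -[leRHS]normrN; have := wl x' x _ (ltW xx).
  have -> : - (pos x ^+ m.+2 - pos x' ^+ m.+2
                 - m.+2%:R * pos e ^+ m.+1 * (pos x - pos x'))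
    = pos x' ^+ m.+2 - pos x ^+ m.+2
        - m.+2%:R * pos e ^+ m.+1 * (pos x' - pos x) by ring.
  by apply; tauto.
rewrite [ `|pos x - pos x'|]ger0_norm ?subr_ge0 //.
have xx0 : 0 <= pos x - pos x' by rewrite subr_ge0.
have m1 : 1 <= m.+2%:R :> R by rewrite ler1n.
have apos v : a <= pos v by have /andP[] := ab v.
have am0 := ltW am.
case: side => -[s s'].
  have ex : pos e <= pos x' by lra.
  have /andP[h _] := pow_tangent m (posb x') (posb x).
  have h2 := pow_increment m (ltW a0) (apos e) ex.
  rewrite ler_normr; apply/orP; left.
  have h3 : D * a ^+ m <= pos x' ^+ m.+1 - pos e ^+ m.+1.
    by apply: le_trans h2; rewrite ler_wpM2r //; lra.
  set P := pos x' ^+ m.+1 in h h3 *; set Q := pos e ^+ m.+1 in h3 *.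
  have h4 : (pos x - pos x') * (D * a ^+ m) <= m.+2%:R * (P - Q) * (pos x - pos x').
    rewrite mulrC ler_wpM2r //; apply: (le_trans h3); rewrite ler_peMl //.
    by apply: le_trans h3; rewrite mulr_ge0.
  by lra.
have ex : pos x <= pos e by lra.
have /andP[h _] := pow_tangent m (posb x) (posb x').
have h2 := pow_increment m (ltW a0) (apos x) ex.
rewrite ler_normr; apply/orP; right.
have h3 : D * a ^+ m <= pos e ^+ m.+1 - pos x ^+ m.+1.
  by apply: le_trans h2; rewrite ler_wpM2r //; lra.
set P := pos x ^+ m.+1 in h h3 *; set Q := pos e ^+ m.+1 in h3 *.
have h4 : (pos x - pos x') * (D * a ^+ m) <= m.+2%:R * (Q - P) * (pos x - pos x').
  rewrite mulrC ler_wpM2r //; apply: (le_trans h3); rewrite ler_peMl //.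
  by apply: le_trans h3; rewrite mulr_ge0.
by lra.
Qed.

Lemma nat_spaced (R : realType) (V : finType) (p : V -> nat) (l : R)
    (A : {set V}) :
    injective p -> 0 <= l -> short (fun v => (p v)%:R) l A ->
  #|A|%:R <= l + 1.
Proof.
move=> injp l0 sA; have [->|[a aA]] := set_0Vmem A; first by rewrite cards0; lra.
have [a0 a0A mina0] := arg_minnP p aA.
apply: (@le_trans _ _ (Num.trunc l).+1%:R); last first.
  by rewrite -natr1 lerD2r truncn_le.
rewrite ler_nat -[X in (_ <= X)%N]card_ord.
have close x : x \in A -> (p x - p a0 < (Num.trunc l).+1)%N.
  move=> xA; rewrite ltnS truncn_ge_nat // natrB ?mina0 //.
  by have := sA x a0 xA a0A; rewrite ler_norml => /andP[].
apply: (@card_le_inj _ _ (fun v => inord (p v - p a0))) => // x y xA yA.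
move=> /(congr1 val); rewrite /= !inordK ?close // => /eqP.
by rewrite eqn_sub2rE ?mina0 // => /eqP/injp.
Qed.

(** * From the system to the energy *)

(** n 2 and n 3 are exchanged between the two sides of the equations, which
    fits the minus sign of triple_sum. *)
Definition arrange (V : Type) (p : V -> nat)
    (t : (V * V * V) * (V * V * V)) : {ffun 'I_6 -> int} :=
  let: ((x0, x1, x3), (x4, x5, x2)) := t in
  [ffun i : 'I_6 => (p (nth x0 [:: x0; x1; x2; x3; x4; x5] i))%:Z].

Lemma card_solutions_le (R : realType) (V : finType) (p : V -> nat)
    (C c1 c2 N : R) (m : nat) :
    let pos v := (p v)%:R in
    0 < c1 -> 0 < N ->
    (forall z : int, sim_to c1 c2 N z -> exists v, z = p v) ->
  finite_set (solutions m.+2 C c1 c2 N) /\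
  (#|` fset_set (solutions m.+2 C c1 c2 N)|
    <= energy pos (fun v => pos v ^+ m.+2 / (c1 * N) ^+ m) (C / c1 ^+ m)
         [set: V] [set: V] [set: V])%N.
Proof.
move=> pos c10 N0 onto; set f := (X in energy _ X); set T := C / _.
pose S := [set t : (V * V * V) * (V * V * V) |
  near_zero T (triple_sum pos f t.1 - triple_sum pos f t.2)].
have cover n : solutions m.+2 C c1 c2 N n -> exists2 t, t \in S & arrange p t = n.
  move=> [sim near lin].
  have /boolp.choice[v nv] : forall i, exists x, n i = p x.
    by move=> i; apply: onto.
  exists ((v 0, v 1, v 3), (v 4, v 5, v 2)); last first.
    apply/ffunP => -[[|[|[|[|[|[|i]]]]]] lti] //=; rewrite ffunE nv /=;
      by congr (Posz (p (v _))); apply: val_inj.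
  move: near lin; rewrite inE /near_zero /triple_sum /= !nv => near lin.
  apply/andP; split.
    move: lin => /(congr1 (fun z : int => z%:~R : R)); rewrite !intrD /pos => lin.
    by apply/eqP; rewrite /pos; lra.
  have a0 : 0 < (c1 * N) ^+ m by rewrite exprn_gt0 ?mulr_gt0.
  move: near; set z := (X in X%:~R); rewrite subn2 /= => near.
  have -> : f (v 0) + f (v 1) - f (v 3) - (f (v 4) + f (v 5) - f (v 2))
      = z%:~R / (c1 * N) ^+ m.
    rewrite /z !(rmorphB, rmorphD, rmorphXn) /= /f /pos.
    by field; rewrite gt_eqF.
  rewrite normrM [ `|_^-1|]gtr0_norm ?invr_gt0 // ler_pdivrMr //.
  by rewrite /T exprMn mulrA divfK // gt_eqF ?exprn_gt0.
pose s := [fset n in [seq arrange p t | t <- enum S]]%fset.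
have sub : (solutions m.+2 C c1 c2 N `<=` [set` s])%classic.
  by move=> n /cover[t tS <-]; rewrite /= /s in_fset /= map_f // mem_enum.
have fin := sub_finite_set sub (finite_fset _); split => //.
have -> : energy pos f T [set: V] [set: V] [set: V] = #|S|.
  by apply: eq_card => t; rewrite !inE.
apply: (@leq_trans #|` s|).
  apply: fsubset_leq_card; apply/fsubsetP => n; rewrite in_fset_set // inE => ns.
  exact: sub.
by rewrite card_fseq (leq_trans (size_undup _)) // size_map cardE.
Qed.

Local Open Scope classical_set_scope.

Theorem theorem2p18 (R : realType) (k : nat) (hk : (2 <= k)%N)
    (C : R) (hC : 0 < C) (c1 c2 : R) (hc1 : 0 < c1) (hc12 : c1 < c2)
    (eps : R) (heps : 0 < eps) :
  exists K : R, forall N : R, 1 <= N ->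
    finite_set (solutions k C c1 c2 N) /\
    #|` fset_set (solutions k C c1 c2 N)|%:R <= K * N `^ (3 + eps).
Proof.
have [m km] : exists m, k = m.+2 by exists (k - 2)%N; lia.
subst k; rewrite {hk}; have c20 : 0 < c2 by lra.
have T0 : 0 < C / c1 ^+ m by rewrite divr_gt0 ?exprn_gt0.
have Lam0 : 0 <= m.+2%:R ^+ 2 * (c2 / c1) ^+ m.
  by rewrite mulr_ge0 ?exprn_ge0 // ltW // divr_gt0.
have [a bound] := energy_bound Lam0 T0 heps.
(* All points lie in an interval of length (c2 + 1) * N; adding 1 to c2 makes
   this length at least 1, as energy_bound requires. *)
exists (a * (c2 + 1) `^ (3 + eps)) => N N1; have N0 : 0 < N by lra.
pose V := {i : 'I_(Num.trunc (c2 * N)).+1 | c1 * N <= (i : nat)%:R <= c2 * N}.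
pose p (v : V) : nat := val v.
have posP (v : V) : c1 * N <= (p v)%:R <= c2 * N by exact: (valP v).
have injp : injective p by move=> x y /val_inj/val_inj.
have onto (z : int) : sim_to c1 c2 N z -> exists v : V, z = p v.
  move=> zs; have /andP[z1 z2] := zs; have z0 : 0 <= z.
    by rewrite -(ler_int R); apply: le_trans z1; rewrite mulr_ge0 ?ltW.
  case: z z0 zs z1 z2 => // n _ zs z1 z2.
  have nlt : (n < (Num.trunc (c2 * N)).+1)%N.
    by rewrite ltnS truncn_ge_nat // mulr_ge0 ?ltW.
  by exists (exist _ (Ordinal nlt) zs).
have [fin card_le] := card_solutions_le C m hc1 N0 onto.
split => //; move: card_le; rewrite -(ler_nat R) => /le_trans; apply.
have crv := pow_curved m (mulr_gt0 hc1 N0) posP.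
rewrite -mulf_div divff ?gt_eqF // mulr1 in crv.
rewrite -mulrA -powRM ?(ltW N0) //; last by lra.
apply: (bound _ _ _ _ _ crv).
- by move=> l A; apply: nat_spaced.
- by nra.
- move=> x y _ _; have := posP x; have := posP y.
  have := mulr_gt0 hc1 N0; rewrite ler_norml; lra.
Qed.
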